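(* Let $d\ge 1$ be an integer and let $A,B\in\mathbb{M}_d^+$. Then there exist unitary matrices $V_1,\ldots,V_d\in\mathbb{M}_d$ such that $$ A\vee B\le \frac{1}{d}\sum_{i=1}^d V_i(A+B)V_i^*. $$
   Context: $\mathbb{M}_d$ is the space of complex $d\times d$ matrices and $\mathbb{M}_d^+$ its cone of positive semidefinite matrices. The inequality $X\le Y$ between Hermitian matrices is the usual (Loewner) order: $Y-X\in\mathbb{M}_d^+$. Spectral order and supremum: for $A\in\mathbb{M}_d^+$ and $x>0$, $\mathbf{1}_{(x,\infty)}(A)$ is the spectral projection of $A$ for the interval $(x,\infty)$. The spectral order on $\mathbb{M}_d^+$ is defined by $A\preceq B$ iff $\mathbf{1}_{(x,\infty)}(A)\le\mathbf{1}_{(x,\infty)}(B)$ for all $x>0$. Any $A,B\in\mathbb{M}_d^+$ have a least upper bound $A\vee B\in\mathbb{M}_d^+$ for $\preceq$; it is the unique matrix $C\in\mathbb{M}_d^+$ with $\mathbf{1}_{(x,\infty)}(C)=\mathbf{1}_{(x,\infty)}(A)\vee\mathbf{1}_{(x,\infty)}(B)$ for all $x>0$, where the join of two orthogonal projections is the orthogonal projection onto the sum of their ranges. *)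

(* Defs.v *)
From HB Require Import structures.
From mathcomp Require Import all_boot all_order all_algebra.
From mathcomp Require Import spectral sesquilinear.
From mathcomp Require Import complex.
From mathcomp Require Import all_classical reals.

Set Implicit Arguments.
Unset Strict Implicit.
Unset Printing Implicit Defensive.

Import Order.TTheory GRing.Theory Num.Theory.

Local Open Scope ring_scope.
Local Open Scope sesquilinear_scope.

Section Definitions.
Context {C : numClosedFieldType} {n : nat}.
Implicit Types A B S : 'M[C]_n.

Definition psdmx A : Prop :=
  A \is hermsymmx /\ forall v : 'cV[C]_n, 0 <= (v^t* *m A *m v) 0 0.

Definition loewner_le A B : Prop := psdmx (B - A).

(* The functional calculus f(A) for f the indicator of ]x, +oo[, computed in  *)
(* the spectral decomposition A = U^-1 diag(d) U of a normal matrix A. The    *)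
(* value does not depend on the decomposition: see spectral_proj_diag.        *)
Definition spectral_proj A (x : C) : 'M[C]_n :=
  invmx (spectralmx A)
    *m diag_mx (\row_i (x < spectral_diag A 0 i)%R%:R)
    *m spectralmx A.

(* In a numClosedFieldType the condition 0 < x entails that x is real.        *)
Definition spectral_le A B : Prop :=
  forall x : C, 0 < x -> loewner_le (spectral_proj A x) (spectral_proj B x).

Definition is_spectral_sup A B S : Prop :=
  [/\ psdmx S, spectral_le A S, spectral_le B S &
      forall D, psdmx D -> spectral_le A D -> spectral_le B D ->
        spectral_le S D].

(* The least upper bound exists and is unique for A and B positive            *)
(* semidefinite: see spectral_joinP and spectral_sup_uniq; the default value  *)
(* 0 is only taken for other arguments.                                       *)
Definition spectral_join A B : 'M[C]_n :=
  xget 0 (is_spectral_sup A B : set 'M[C]_n).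

End Definitions.

Section Theory.
Context {C : numClosedFieldType}.

Lemma adjM m n p (A : 'M[C]_(m, n)) (B : 'M[C]_(n, p)) :
  (A *m B)^t* = B^t* *m A^t*.
Proof. by rewrite trmx_mul map_mxM. Qed.

Lemma adjB m n (A B : 'M[C]_(m, n)) : (A - B)^t* = A^t* - B^t*.
Proof. by rewrite linearB /= map_mxB. Qed.

Lemma adj1 n : (1%:M : 'M[C]_n)^t* = 1%:M.
Proof. by rewrite trmx1 map_mx1. Qed.

Lemma hermE n (A : 'M[C]_n) : (A \is hermsymmx) <-> (A^t* = A).
Proof.
split; first by move=> /is_hermitianmxP; rewrite expr0 scale1r => <-.
by move=> h; apply/is_hermitianmxP; rewrite expr0 scale1r h.
Qed.

Lemma gram_ge0 n (w : 'cV[C]_n) : 0 <= (w^t* *m w) 0 0.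
Proof.
rewrite mxE; apply: sumr_ge0 => i _; rewrite !mxE mulrC; exact: mul_conjC_ge0.
Qed.

Lemma gram_eq0 n (w : 'cV[C]_n) : (w^t* *m w) 0 0 <= 0 -> w = 0.
Proof.
move=> le0; have /eqP : (w^t* *m w) 0 0 = 0.
  by apply/eqP; rewrite eq_le le0 gram_ge0.
rewrite mxE psumr_eq0; last first.
  by move=> i _; rewrite !mxE mulrC; exact: mul_conjC_ge0.
move=> /allP h; apply/colP => i; rewrite [RHS]mxE; apply/eqP.
by have := h i (mem_index_enum i); rewrite !mxE /= mulrC mul_conjC_eq0.
Qed.

Definition oprojmx n (P : 'M[C]_n) := (P^t* = P) /\ (P *m P = P).

Lemma oproj_le n (P Q : 'M[C]_n) : oprojmx P -> oprojmx Q ->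
  loewner_le P Q <-> (P <= Q)%MS.
Proof.
move=> [Ph Pi] [Qh Qi]; split=> [[_ h]|/submxP[D PE]].
  suff -> : P = P *m Q by exact: submxMl.
  have h0 (v : 'cV[C]_n) : P *m ((1%:M - Q) *m v) = 0.
    apply: gram_eq0; have := h ((1%:M - Q) *m v).
    have QM : Q *m ((1%:M - Q) *m v) = 0.
      by rewrite mulmxA mulmxBr mulmx1 Qi subrr mul0mx.
    set w := _ *m v in QM *.
    rewrite -mulmxA (mulmxBl Q P w) QM sub0r mulmxN mxE oppr_ge0.
    by rewrite (adjM P w) Ph -(mulmxA _ P) [P *m (P *m _)]mulmxA Pi.
  have : P *m (1%:M - Q) = 0.
    apply/matrixP => i j; have /colP/(_ i) := h0 (delta_mx j 0).
    by rewrite mulmxA -colE !mxE.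
  by rewrite mulmxBr mulmx1 => /eqP; rewrite subr_eq0 => /eqP.
have PQ : P *m Q = P by rewrite PE -mulmxA Qi.
have QP : Q *m P = P by rewrite -{1}Ph -{1}Qh -adjM PQ Ph.
have Dh : (Q - P)^t* = Q - P by rewrite adjB Ph Qh.
have Di : (Q - P) *m (Q - P) = Q - P.
  by rewrite mulmxBr !mulmxBl Qi QP PQ Pi subrr subr0.
split; first exact/hermE.
by move=> v; rewrite -Di -{1}Dh mulmxA -mulmxA -adjM gram_ge0.
Qed.

Lemma oproj_subP n (P Q : 'M[C]_n) : oprojmx Q ->
  reflect (P = P *m Q) (P <= Q)%MS.
Proof.
move=> [_ Qi]; apply: (iffP submxP) => [[D ->]|->]; last by exists P.
by rewrite -mulmxA Qi.
Qed.

Lemma oproj_eq n (P Q : 'M[C]_n) : oprojmx P -> oprojmx Q ->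
  (P == Q)%MS -> P = Q.
Proof.
move=> Pp Qp /andP[/(oproj_subP _ Qp) PQ /(oproj_subP _ Pp) QP].
by rewrite PQ -Pp.1 -{1}Qp.1 -adjM -QP Qp.1.
Qed.

Lemma oproj_exists n m (U : 'M[C]_(m, n)) :
  exists P : 'M[C]_n, oprojmx P /\ (P :=: U)%MS.
Proof.
pose W := schmidt (row_base U).
have Wu : W *m W^t* = 1%:M.
  by apply/unitarymxP/schmidt_unitarymx; exact: rank_leq_col.
exists (W^t* *m W); split; first split.
- by rewrite adjM trmxCK.
- by rewrite mulmxA -[_ *m W *m _]mulmxA Wu mulmx1.
have WU : (W :=: U)%MS.
  apply: eqmx_trans (eq_row_base U).
  by apply: eqmx_schmidt_free; exact: row_base_free.
apply: eqmx_trans WU.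
apply/eqmxP; rewrite submxMl /=.
by rewrite -{1}[W]mul1mx -Wu -mulmxA submxMl.
Qed.

Lemma herm_spectral n (A : 'M[C]_n) : A \is hermsymmx ->
  A = invmx (spectralmx A) *m diag_mx (spectral_diag A) *m spectralmx A.
Proof. by move=> /hermitian_normalmx /orthomx_spectralP. Qed.

Lemma intertwine n (U V : 'M[C]_n) (a b : 'rV[C]_n) :
  U \in unitmx -> V \in unitmx ->
  invmx U *m diag_mx a *m U = invmx V *m diag_mx b *m V <->
  forall i j, (U *m invmx V) i j * b 0 j = a 0 i * (U *m invmx V) i j.
Proof.
move=> Uu Vu; set M := U *m invmx V.
have -> : (invmx U *m diag_mx a *m U = invmx V *m diag_mx b *m V) <->
          (M *m diag_mx b = diag_mx a *m M).
  split=> h.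
    rewrite /M.
    have -> : diag_mx a *m (U *m invmx V) =
              U *m (invmx U *m diag_mx a *m U) *m invmx V.
      by rewrite !mulmxA mulmxV // mul1mx.
    by rewrite h !mulmxA mulmxK.
  have dU : diag_mx a *m U = M *m diag_mx b *m V.
    by rewrite h /M -!mulmxA mulVmx // mulmx1.
  by rewrite -[LHS]mulmxA dU /M !mulmxA mulVmx // mul1mx.
rewrite mul_mx_diag mul_diag_mx.
split=> [/matrixP h i j|h]; first by have := h i j; rewrite !mxE.
by apply/matrixP => i j; rewrite !mxE; have := h i j; rewrite !mxE.
Qed.

Lemma spectral_proj_diag n (U : 'M[C]_n) (c : 'rV[C]_n) (A : 'M[C]_n) x :
  A \is hermsymmx -> U \in unitmx -> A = invmx U *m diag_mx c *m U ->
  spectral_proj A x = invmx U *m diag_mx (\row_i (x < c 0 i)%R%:R) *m U.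
Proof.
move=> Ah Uu AE; have := herm_spectral Ah; rewrite {1}AE.
move=> /(intertwine _ _ Uu (spectral_unit A)) h.
apply/esym/intertwine => //; first exact: spectral_unit.
move=> i j; have := h i j; rewrite !mxE; set m := \sum_k _.
have [->|m0] := eqVneq m 0; first by rewrite !(mul0r, mulr0).
by move=> e; rewrite (mulfI m0 (etrans e (mulrC _ _))) mulrC.
Qed.

Lemma conj_diag_herm n (U : 'M[C]_n) (c : 'rV[C]_n) : U \is unitarymx ->
  (forall i, c 0 i \is Num.real) ->
  (invmx U *m diag_mx c *m U) \is hermsymmx.
Proof.
move=> Uu cr; apply/hermE; rewrite !adjM invmx_unitary // trmxCK.
rewrite tr_diag_mx map_diag_mx mulmxA; congr (_ *m diag_mx _ *m _).
by apply/rowP => i; rewrite mxE; apply/CrealP.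
Qed.

Lemma conj_diag_psd n (U : 'M[C]_n) (c : 'rV[C]_n) : U \is unitarymx ->
  (forall i, 0 <= c 0 i) -> psdmx (invmx U *m diag_mx c *m U).
Proof.
move=> Uu c0; split; first by apply: conj_diag_herm => // i; exact: ger0_real.
move=> v; rewrite invmx_unitary // !mulmxA -adjM -[_ *m U *m v]mulmxA.
set w := U *m v; rewrite mul_mx_diag mxE; apply: sumr_ge0 => i _.
by rewrite !mxE mulrAC mulr_ge0 // mulrC mul_conjC_ge0.
Qed.

Lemma spectral_oproj n (A : 'M[C]_n) x : oprojmx (spectral_proj A x).
Proof.
have Uu := spectral_unitarymx A; split.
  apply/hermE; apply: conj_diag_herm => // i.
  by rewrite mxE; apply: ger0_real; case: (_ < _).
rewrite /spectral_proj !mulmxA mulmxK ?spectral_unit //.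
rewrite -[_ *m diag_mx _ *m diag_mx _]mulmxA mulmx_diag.
congr (_ *m diag_mx _ *m _); apply/rowP => i; rewrite !mxE.
by case: (_ < _); rewrite ?mulr1 ?mulr0.
Qed.

Lemma spectral_leP n (A B : 'M[C]_n) : spectral_le A B <->
  (forall x, 0 < x -> (spectral_proj A x <= spectral_proj B x)%MS).
Proof.
split=> h x x0; first by apply/oproj_le; [exact: spectral_oproj..|exact: h].
by apply/oproj_le; [exact: spectral_oproj..|exact: h].
Qed.

Lemma psd_diag_ge0 n (A : 'M[C]_n) i : psdmx A -> 0 <= spectral_diag A 0 i.
Proof.
move=> [Ah Ap]; have := Ap ((row i (spectralmx A))^t*).
rewrite trmxCK [X in _ *m X *m _](herm_spectral Ah).
have Uu := spectral_unitarymx A; rewrite invmx_unitary //.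
set U := spectralmx A in Uu *; set d := spectral_diag A.
have -> : row i U *m (U^t* *m diag_mx d *m U) *m (row i U)^t* =
          row i (U *m U^t* *m diag_mx d *m (U *m U^t*)) *m delta_mx i 0.
  rewrite !rowE !adjM !mulmxA; congr (_ *m _).
  by apply/colP => k; rewrite !mxE !eqxx andbT rmorph_nat.
by rewrite (unitarymxP Uu) mul1mx mulmx1 -colE !mxE eqxx.
Qed.

Lemma spectral_le_anti n (A B : 'M[C]_n) : psdmx A -> psdmx B ->
  spectral_le A B -> spectral_le B A -> A = B.
Proof.
move=> Ap Bp /spectral_leP AB /spectral_leP BA.
rewrite (herm_spectral Ap.1) (herm_spectral Bp.1).
have Au := spectral_unit A; have Bu := spectral_unit B.
apply/intertwine => // i j; set m := (_ *m _) i j.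
have [->|m0] := eqVneq m 0; first by rewrite mul0r mulr0.
set a := spectral_diag A 0 i; set b := spectral_diag B 0 j.
have h x : 0 < x -> (x < a) = (x < b).
  move=> x0; have : spectral_proj A x = spectral_proj B x.
    by apply: oproj_eq; [exact: spectral_oproj..|rewrite AB // BA].
  move=> /(intertwine _ _ Au Bu)/(_ i j).
  rewrite -/m !mxE -/a -/b mulrC => /(mulIf m0).
  by case: (_ < _); case: (_ < _) => // /eqP; rewrite ?oner_eq0 // eq_sym oner_eq0.
have a0 : 0 <= a by exact: psd_diag_ge0.
have b0 : 0 <= b by exact: psd_diag_ge0.
have key (u v : C) : 0 <= u -> 0 <= v ->
    (forall x : C, 0 < x -> (x < u) = (x < v)) -> ~~ (u < v).
  move=> u0 v0 uv; apply/negP => ltuv; move: u0.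
  rewrite le_eqVlt => /orP[/eqP u0|u0]; last first.
    by have := uv _ u0; rewrite ltxx ltuv.
  have v1 : 0 < v by rewrite u0.
  have vh : 0 < v / 2 by rewrite divr_gt0.
  have : v / 2 < u by rewrite uv // ltr_pdivrMr // ltr_pMr // ltr1n.
  by rewrite -u0 => /(lt_trans vh); rewrite ltxx.
have ab : ~~ (a < b) by exact: key.
have ba : ~~ (b < a) by apply: key => // x x0; rewrite h.
suff -> : a = b by rewrite mulrC.
by case: (real_ltgtP (ger0_real a0) (ger0_real b0)) ab ba.
Qed.

Lemma seq_max (s : seq C) (p : pred C) :
  (forall t, t \in s -> t \is Num.real) -> has p s ->
  exists2 m, (m \in s) && p m & forall y, y \in s -> p y -> y <= m.
Proof.
elim: s => // a s IH sr /=; have ar : a \is Num.real by apply: sr; exact: mem_head.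
have sr' t : t \in s -> t \is Num.real.
  by move=> ts; apply: sr; rewrite in_cons ts orbT.
case: (boolP (has p s)) => [hs _|hs].
  have [m /andP[ms pm] hm] := IH sr' hs.
  case: (boolP (p a && (m <= a))) => [/andP[pa ma]|npa].
    exists a; first by rewrite mem_head.
    move=> y; rewrite in_cons => /orP[/eqP->//|ys py].
    exact: le_trans (hm _ ys py) ma.
  exists m; first by rewrite in_cons ms orbT.
  move=> y; rewrite in_cons => /orP[/eqP-> pa|]; last exact: hm.
  by move: npa; rewrite pa /= -(real_ltNge ar (sr' _ ms)) => /ltW.
rewrite orbF => pa; exists a; first by rewrite mem_head.
move=> y; rewrite in_cons => /orP[/eqP->//|ys py].
by case/hasP: hs; exists y.
Qed.

Lemma seq_min (s : seq C) (p : pred C) :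
  (forall t, t \in s -> t \is Num.real) -> has p s ->
  exists2 m, (m \in s) && p m & forall y, y \in s -> p y -> m <= y.
Proof.
move=> sr /hasP[t ts pt].
have [||m /andP[/mapP[u us ->] pu] hm] :=
  @seq_max [seq - x | x <- s] (fun x => p (- x)).
- by move=> _ /mapP[u us ->]; rewrite realN sr.
- by apply/hasP; exists (- t); rewrite ?map_f ?opprK.
exists u; first by rewrite us -[u]opprK.
by move=> y ys py; rewrite -lerN2; apply: hm; rewrite ?map_f ?opprK.
Qed.

Lemma nested_diag n (I : eqType) (s : seq I) (Q : I -> 'M[C]_n) :
  (forall i, oprojmx (Q i)) ->
  {in s &, forall i j, (Q i <= Q j)%MS || (Q j <= Q i)%MS} ->
  exists2 U : 'M[C]_n, U \is unitarymx &
    exists q : I -> 'rV[C]_n,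
      {in s, forall i, Q i = invmx U *m diag_mx (q i) *m U}.
Proof.
move=> Qp Qn.
have [|U Uu /allP /= UQ] := @cotrigonalization C n [seq Q i | i <- s].
  move=> _ _ /mapP[i si ->] /mapP[j sj ->].
  have comm k l : (Q k <= Q l)%MS -> Q k *m Q l = Q l *m Q k.
    move=> /(oproj_subP _ (Qp l)) e; rewrite -e.
    by rewrite -{2}(Qp k).1 -{1}(Qp l).1 -adjM -e (Qp k).1.
  by case/orP: (Qn i j si sj) => /comm.
exists U => //; have Uu' := unitarymx_unit Uu.
exists (fun i => \row_k (U *m Q i *m U^t*) k k) => i si.
set D := diag_mx _.
suff DE : U *m Q i *m U^t* = D.
  by rewrite -DE !mulmxA mulVmx // mul1mx mulmxKtV.
have /is_trig_mxP Mt : is_trig_mx (U *m Q i *m U^t*).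
  by have := UQ _ (map_f Q si); rewrite /similar_to conjymx.
have Mh : (U *m Q i *m U^t*)^t* = U *m Q i *m U^t*.
  by rewrite !adjM trmxCK (Qp i).1 mulmxA.
apply/matrixP => k l; rewrite /D [RHS]mxE [in RHS]mxE; case: (ltngtP k l).
- move=> kl; rewrite Mt //.
  by case: eqP kl => [->|]; rewrite ?ltnn.
- move=> lk; rewrite -Mh 2!mxE Mt // conjC0.
  by case: eqP lk => [->|]; rewrite ?ltnn.
- by move=> /ord_inj->; rewrite eqxx.
Qed.

Lemma spectral_join_exists n (A B : 'M[C]_n) : psdmx A -> psdmx B ->
  exists2 S : 'M[C]_n, psdmx S & forall x, 0 < x ->
    (spectral_proj S x :=: spectral_proj A x + spectral_proj B x)%MS.
Proof.
move=> Ap Bp.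
pose a i := spectral_diag A 0 i; pose b i := spectral_diag B 0 i.
pose T : seq C := 0 :: [seq a i | i <- enum 'I_n] ++ [seq b i | i <- enum 'I_n].
have T0 t : t \in T -> 0 <= t.
  rewrite in_cons mem_cat => /orP[/eqP->//|/orP[]/mapP[i _ ->]];
  exact: psd_diag_ge0.
have Tr t : t \in T -> t \is Num.real by move=> /T0; exact: ger0_real.
have Ta i : a i \in T by rewrite in_cons mem_cat map_f ?mem_enum ?orbT.
have Tb i : b i \in T by rewrite in_cons mem_cat (map_f b) ?mem_enum ?orbT.
have /choice[Q QE] := fun x =>
  oproj_exists (spectral_proj A x + spectral_proj B x)%MS.
have Qp x := (QE x).1; have {}QE x := (QE x).2.
have proj_ext (D : 'M[C]_n) x y :
    (forall i, (x < spectral_diag D 0 i) = (y < spectral_diag D 0 i)) ->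
    spectral_proj D x = spectral_proj D y.
  move=> xy; rewrite /spectral_proj; congr (_ *m diag_mx _ *m _).
  by apply/rowP => i; rewrite !mxE xy.
have Q_ext x y : (forall t, t \in T -> (x < t) = (y < t)) -> Q x = Q y.
  move=> xy; apply: oproj_eq => //; rewrite !QE.
  rewrite (proj_ext A x y) ?(proj_ext B x y) ?submx_refl // => i.
    by rewrite xy ?Tb.
  by rewrite xy ?Ta.
have proj_mono (D : 'M[C]_n) x y : D \is hermsymmx -> x <= y ->
    (spectral_proj D y <= spectral_proj D x)%MS.
  move=> Dh xy; apply/(oproj_subP _ (spectral_oproj D x)).
  rewrite /spectral_proj !mulmxA mulmxK ?spectral_unit //.
  rewrite -[_ *m diag_mx _ *m diag_mx _]mulmxA mulmx_diag.
  congr (_ *m diag_mx _ *m _); apply/rowP => i; rewrite !mxE.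
  case: (boolP (y < _)) => [yd|]; last by rewrite mul0r.
  by rewrite (le_lt_trans xy yd) mulr1.
have Q_mono x y : x <= y -> (Q y <= Q x)%MS.
  by move=> xy; rewrite !QE addsmxS // proj_mono //; [case: Ap|case: Bp].
have [|U Uu [q qE]] := @nested_diag n _ T Q Qp.
  move=> x y /Tr xr /Tr yr.
  by case/orP: (real_leVge xr yr) => /Q_mono ->; rewrite ?orbT.
have Uu' := unitarymx_unit Uu.
have q_mono i : {in T &, forall x y, x <= y -> q y 0 i = 1 -> q x 0 i = 1}.
  move=> x y xT yT /Q_mono /(oproj_subP _ (Qp x)).
  rewrite !qE // !mulmxA mulmxK // -[_ *m diag_mx _ *m diag_mx _]mulmxA.
  rewrite mulmx_diag => /(intertwine _ _ Uu' Uu')/(_ i i).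
  by rewrite mulmxV // !mxE eqxx mul1r mulr1 => e y1; move: e; rewrite y1 mul1r.
have q01 x i : x \in T -> q x 0 i = (q x 0 i == 1)%:R.
  move=> xT; have := (Qp x).2.
  rewrite !qE // !mulmxA mulmxK // -[_ *m diag_mx _ *m diag_mx _]mulmxA.
  rewrite mulmx_diag => /(intertwine _ _ Uu' Uu')/(_ i i).
  rewrite mulmxV // !mxE eqxx mul1r mulr1 => e.
  have [->//|q1] := eqVneq (q x 0 i) 1.
  apply/eqP; move/eqP: e; rewrite eq_sym -subr_eq0.
  by rewrite -{3}[q x 0 i]mulr1 -mulrBr mulf_eq0 subr_eq0 (negPf q1) orbF.
pose good i t := all (fun s => (s < t) ==> (q s 0 i == 1)) T.
have good0 i : has (good i) T.
  apply/hasP; exists 0; first exact: mem_head.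
  by apply/allP => s /T0 s0; rewrite le_gtF.
have /choice[c cP] : forall i, exists m, [/\ m \in T, good i m &
    forall y, y \in T -> good i y -> y <= m].
  by move=> i; have [m /andP[]] := seq_max Tr (good0 i); exists m.
pose S := invmx U *m diag_mx (\row_i c i) *m U.
have Sp : psdmx S.
  by apply: conj_diag_psd => // i; rewrite mxE; have [/T0] := cP i.
exists S => // x x0.
have xr := gtr0_real x0.
have [|s /andP[sT sx] smax] := @seq_max T (fun t => t <= x) Tr.
  by apply/hasP; exists 0; [exact: mem_head|exact: ltW].
have xs t : t \in T -> (x < t) = (s < t).
  move=> tT; apply/idP/idP => [|st]; first exact: le_lt_trans.
  rewrite (real_ltNge xr (Tr _ tT)); apply/negP => tx.
  by have := lt_le_trans st (smax _ tT tx); rewrite ltxx.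
suff -> : spectral_proj S x = Q x by exact: QE.
rewrite (Q_ext x s) // qE //.
rewrite (spectral_proj_diag _ Sp.1 Uu' erefl).
suff -> : \row_i (x < (\row_i0 c i0) 0 i)%R%:R = q s by [].
apply/rowP => i; rewrite !mxE (q01 s) //; congr (_%:R).
have [cT cg cmax] := cP i; congr nat_of_bool.
apply/idP/idP => [xc|/eqP q1].
  move/allP: cg => /(_ _ sT)/implyP; apply; exact: le_lt_trans xc.
rewrite (real_ltNge xr (Tr _ cT)); apply/negP => cx.
case: (boolP (has (fun t => s < t) T)) => [hs|/hasPn hs]; last first.
  have Z (D : 'M[C]_n) : (forall i, spectral_diag D 0 i \in T) ->
      spectral_proj D s = 0.
    move=> DT; rewrite /spectral_proj (_ : \row_i0 _ = 0).
      by rewrite (linear0 (@diag_mx C n)) mulmx0 mul0mx.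
    by apply/rowP => k; rewrite !mxE (negPf (hs _ (DT k))).
  have : Q s = 0.
    by apply/eqP; rewrite -submx0 QE !Z // addsmx0.
  rewrite qE // => /(congr1 (fun M => U *m M *m invmx U)).
  rewrite mulmx0 mul0mx !mulmxA mulmxV // mul1mx mulmxK // => /matrixP/(_ i i).
  by rewrite !mxE eqxx q1 => /eqP; rewrite oner_eq0.
have [t /andP[tT st] tmin] := seq_min Tr hs.
have gt : good i t.
  apply/allP => u uT; apply/implyP => ut; apply/eqP.
  apply: (q_mono i u s) => //; rewrite real_leNgt ?Tr //.
  by apply/negP => /(tmin _ uT) /(lt_le_trans ut); rewrite ltxx.
have := le_trans (cmax _ tT gt) cx; move=> /(smax _ tT) /(lt_le_trans st).
by rewrite ltxx.
Qed.

Lemma spectral_supP n (A B S : 'M[C]_n) : psdmx S ->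
  (forall x, 0 < x ->
    (spectral_proj S x :=: spectral_proj A x + spectral_proj B x)%MS) ->
  is_spectral_sup A B S.
Proof.
move=> Sp SE; split=> //.
- by apply/spectral_leP => x x0; rewrite SE // addsmxSl.
- by apply/spectral_leP => x x0; rewrite SE // addsmxSr.
move=> D Dp /spectral_leP AD /spectral_leP BD; apply/spectral_leP => x x0.
by rewrite SE // addsmx_sub AD // BD.
Qed.

Lemma spectral_sup_uniq n (A B S S' : 'M[C]_n) :
  is_spectral_sup A B S -> is_spectral_sup A B S' -> S = S'.
Proof.
move=> [Sp AS BS Sm] [Sp' AS' BS' Sm'].
by apply: spectral_le_anti; [..|exact: Sm|exact: Sm'].
Qed.

Lemma spectral_joinP n (A B : 'M[C]_n) : psdmx A -> psdmx B ->
  is_spectral_sup A B (spectral_join A B).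
Proof.
move=> Ap Bp; have [S Sp SE] := spectral_join_exists Ap Bp.
have SP := spectral_supP Sp SE.
by rewrite /spectral_join; apply: (@xgetPex _ 0 (is_spectral_sup A B)); exists S.
Qed.

(* Row spaces are used here, but an orthogonal projection is Hermitian, so it *)
(* is determined by its row space just as it is by its range.                 *)
Lemma spectral_proj_join n (A B : 'M[C]_n) x : psdmx A -> psdmx B -> 0 < x ->
  (spectral_proj (spectral_join A B) x
     :=: spectral_proj A x + spectral_proj B x)%MS.
Proof.
move=> Ap Bp x0; have [S Sp SE] := spectral_join_exists Ap Bp.
rewrite (spectral_sup_uniq (spectral_joinP Ap Bp) (spectral_supP Sp SE)).
exact: SE.
Qed.

End Theory.

(* Main.v *)
(* List the unit eigenvectors of A and B together, by decreasing eigenvalue,  *)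
(* and apply Gram-Schmidt, discarding the vectors that depend on earlier      *)
(* ones. The result is an orthonormal basis e_1, ..., e_d, and the            *)
(* eigenvalues s_1 >= ... >= s_d attached to the vectors kept are those of    *)
(* A \/ B, with eigenvectors e_k. The span of e_1, ..., e_j contains the j    *)
(* first vectors kept, so the compression of A + B to it has trace at least   *)
(* s_1 + ... + s_j. By the argument of Schur and Horn, plane rotations then   *)
(* make every diagonal entry of A + B at least the corresponding s_k, and     *)
(* the diagonal part of a matrix is the average of its conjugates by the d    *)
(* powers of diag(1, z, ..., z^(d-1)), z being a primitive d-th root of 1.    *)

Require Import Defs.
From HB Require Import structures.
From mathcomp Require Import all_boot all_order all_algebra.
From mathcomp Require Import spectral sesquilinear.
From mathcomp Require Import complex.
From mathcomp Require Import all_classical reals.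
From mathcomp Require Import cyclic separable cyclotomic ring.

Set Implicit Arguments.
Unset Strict Implicit.
Unset Printing Implicit Defensive.

Import Order.TTheory GRing.Theory Num.Theory.

Local Open Scope ring_scope.
Local Open Scope sesquilinear_scope.

(** All comparisons take place in one orthonormal basis that diagonalises the join with decreasing
    eigenvalues s_k ([spectral_join_eigenbasis], resting on [greedy_gram_schmidt]). In that basis A
    + B need not dominate the join, but the prefix sums of its diagonal dominate those of s: each
    kept eigenvector of rank i <= j lies in the span of the first j basis vectors, so it contributes
    its whole eigenvalue s_i to the trace of the compression, and the other eigenvectors contribute
    nonnegative terms. [unitary_diag_dominates] upgrades this weak majorization to entrywise
    domination by a unitary conjugation. [pinching] then replaces the conjugate by its diagonal
    part, which is compared with diag(s) entry by entry. *)

Section UnitaryMixing.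
Context {C : numClosedFieldType}.

(** * Roots of unity and the diagonal part as an average *)

(** In characteristic zero ['X^n - 1] is separable, so its splitting gives n distinct n-th roots of
    unity, and one of them is primitive. *)
Lemma prim_root_exists n : (0 < n)%N -> exists z : C, n.-primitive_root z.
Proof.
move=> n0; have [r rE] := closed_field_poly_normal ('X^n - 1 : {poly C}).
have lc : lead_coef ('X^n - 1 : {poly C}) = 1.
  exact/eqP/(monicXnsubC 1 n0).
rewrite lc scale1r in rE.
have /hasP[z _ zP] : has n.-primitive_root r; last by exists z.
apply: has_prim_root => //.
- apply/allP => z zr; rewrite unity_rootE -subr_eq0 -hornerXn.
  rewrite -[X in _ - X](hornerC 1 z) -hornerN -hornerD polyC1 rE -rootE.
  by rewrite root_prod_XsubC.
- by rewrite -separable_prod_XsubC -rE separable_Xn_sub_1 // pnatr_eq0 -lt0n.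
- have := congr1 (fun p : {poly C} => size p) rE.
  by rewrite size_XnsubC // size_prod_XsubC => -[->].
Qed.

Lemma pinching n (M : 'M[C]_n) : (0 < n)%N ->
  exists V : 'I_n -> 'M[C]_n, (forall i, V i \is unitarymx) /\
    n%:R^-1 *: \sum_(i < n) V i *m M *m (V i)^t* = diag_mx (\row_i M i i).
Proof.
move=> n0; have [z zP] := prim_root_exists n0.
have zn : z ^+ n = 1 := prim_expr_order zP.
have z1 : z * z^* = 1.
  rewrite -normCK; have /eqP := congr1 Num.norm zn.
  by rewrite normrX normr1 pexpr_eq1 // => /eqP->; rewrite expr1n.
have z0 : z != 0.
  by apply/eqP => z0; move/eqP: z1; rewrite z0 mul0r eq_sym oner_eq0.
have zV : z^* = z^-1 by apply: (mulfI z0); rewrite z1 mulfV.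
exists (fun i => diag_mx (\row_k z ^+ (i * k))); split.
  move=> i; apply/unitarymxP; rewrite tr_diag_mx map_diag_mx mulmx_diag.
  rewrite -diag_const_mx; congr diag_mx; apply/rowP => k.
  by rewrite !mxE rmorphXn /= -exprMn z1 expr1n.
apply/matrixP => k l; rewrite mxE summxE.
(* Since z has modulus 1, x is z^(k - l). The i-th conjugation multiplies entry (k, l) by x^i. These
   powers sum to n if k = l, and otherwise to 0, because x is then an n-th root of unity other than
   1. *)
pose x := z ^+ k * z^* ^+ l.
have entryE (i : 'I_n) : (diag_mx (\row_j z ^+ (i * j)) *m M *m
    (diag_mx (\row_j z ^+ (i * j)))^t*) k l = x ^+ i * M k l.
  rewrite tr_diag_mx map_diag_mx mul_mx_diag mul_diag_mx !mxE rmorphXn /=.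
  by rewrite mulrAC !(mulnC i) !exprM -exprMn.
under eq_bigr do rewrite entryE.
rewrite -mulr_suml !mxE; case: (eqVneq k l) => [kl|kl].
  have -> : x = 1 by rewrite /x kl -exprMn z1 expr1n.
  under eq_bigr do rewrite expr1n.
  rewrite sumr_const card_ord mulrA mulVf ?mul1r ?mulr1n ?kl //.
  by rewrite pnatr_eq0 -lt0n.
rewrite mulr0n; suff -> : \sum_(i < n) x ^+ i = 0 by rewrite mul0r mulr0.
have xn : x ^+ n = 1.
  rewrite /x exprMn -!exprM !(mulnC _ n) !exprM zn zV exprVn zn invr1.
  by rewrite !expr1n mulr1.
have x1 : x - 1 != 0.
  rewrite subr_eq0 /x zV exprVn -(inj_eq (mulIf (expf_neq0 l z0))).
  by rewrite mulfVK ?expf_neq0 // mul1r (eq_prim_root_expr zP) !modn_small.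
by apply: (mulfI x1); rewrite -subrX1 xn subrr mulr0.
Qed.

(** * Plane rotations and the Schur-Horn argument *)

(** Its additivity and scaling rules expand the entries of W N W^* row by row. Below, N = 1 gives
    unitarity of the rotation and N = M its effect on the diagonal. *)
Definition mxform n (N : 'M[C]_n) (u v : 'rV_n) : C := (u *m N *m v^t*) 0 0.

Lemma mxformDl n (N : 'M[C]_n) u1 u2 v :
  mxform N (u1 + u2) v = mxform N u1 v + mxform N u2 v.
Proof. by rewrite /mxform !mulmxDl mxE. Qed.

Lemma mxformDr n (N : 'M[C]_n) u v1 v2 :
  mxform N u (v1 + v2) = mxform N u v1 + mxform N u v2.
Proof. by rewrite /mxform linearD map_mxD mulmxDr mxE. Qed.

Lemma mxformZl n (N : 'M[C]_n) x u v :
  mxform N (x *: u) v = x * mxform N u v.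
Proof. by rewrite /mxform -!scalemxAl mxE. Qed.

Lemma mxformZr n (N : 'M[C]_n) x u v :
  mxform N u (x *: v) = x^* * mxform N u v.
Proof. by rewrite /mxform linearZ map_mxZ -scalemxAr mxE. Qed.

Lemma mxform_delta n (N : 'M[C]_n) i j :
  mxform N (delta_mx 0 i) (delta_mx 0 j) = N i j.
Proof. by rewrite /mxform trmx_delta map_delta_mx -rowE -colE !mxE. Qed.

Lemma mxform_row m n (N : 'M[C]_n) (W : 'M_(m, n)) k l :
  mxform N (row k W) (row l W) = (W *m N *m W^t*) k l.
Proof.
by rewrite /mxform -row_mul !mxE; apply: eq_bigr => i _; rewrite !mxE.
Qed.

Lemma diag_average n (M : 'M[C]_n) (i j : 'I_n) (a : C) :
  M^t* = M -> i != j -> 0 <= a <= 1 ->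
  exists2 W : 'M[C]_n, W \is unitarymx & forall k, (W *m M *m W^t*) k k =
    if k == i then a * M i i + (1 - a) * M j j
    else if k == j then (1 - a) * M i i + a * M j j else M k k.
Proof.
move=> Mh ij /andP[a0 a1].
pose p := sqrtC a; pose q := sqrtC (1 - a).
have pc : p^* = p by apply/CrealP/ger0_real; rewrite sqrtC_ge0.
have qc : q^* = q by apply/CrealP/ger0_real; rewrite sqrtC_ge0 subr_ge0.
have pp : p * p = a by rewrite -expr2 sqrtCK.
have qq : q * q = 1 - a by rewrite -expr2 sqrtCK.
(* The phase w cancels the off-diagonal terms of the rotated matrix. *)
have [w ww wM] :
    exists2 w : C, w * w^* = 1 & w * M j i + w^* * M i j = 0.
  have Mij : M i j = (M j i)^* by rewrite -[in LHS]Mh !mxE.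
  have [z0|z0] := eqVneq (M j i) 0.
    by exists 1; rewrite ?Mij ?z0 ?rmorph0 ?rmorph1 ?mulr0 ?addr0 ?mulr1.
  have n0 : `|M j i| != 0 by rewrite normr_eq0.
  (* This phase makes w M_ji equal to 'i |M_ji|, which is purely imaginary, so it cancels against
     its conjugate. *)
  exists ('i * (M j i)^* / `|M j i|).
    rewrite !rmorphM fmorphV /= conjCK (CrealP (normr_real _)) conjCi.
    rewrite [LHS](_ : _ = - ('i * 'i) * (M j i * (M j i)^*) / `|M j i| ^+ 2);
      last by field.
    by rewrite -expr2 sqrCi opprK mul1r -normCK mulfV // expf_neq0.
  rewrite !rmorphM fmorphV /= conjCK (CrealP (normr_real _)) conjCi Mij; ring.
pose r (k : 'I_n) : 'rV[C]_n :=
  if k == i then p *: delta_mx 0 i + (q * w) *: delta_mx 0 j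
  else if k == j then (- (q * w^*)) *: delta_mx 0 i + p *: delta_mx 0 j
  else delta_mx 0 k.
pose W := \matrix_k r k.
have formW N k l : (W *m N *m W^t*) k l = mxform N (r k) (r l).
  by rewrite -mxform_row !rowK.
have fE :=
  (mxformDl, mxformDr, mxformZl, mxformZr, mxform_delta, rmorphM, rmorphN).
exists W.
  apply/unitarymxP; rewrite -[W]mulmx1; apply/matrixP => k l.
  rewrite mulmx1 -{1}[W]mulmx1 formW /r mxE.
  have ji : (j == i) = false by rewrite eq_sym (negPf ij).
  have pq : p * p + q * q * (w * w^*) = 1 by rewrite ww mulr1 pp qq subrKC.
  have [ki|ki] := eqVneq k i; [|have [kj|kj] := eqVneq k j];
    (have [li|li] := eqVneq l i; [|have [lj|lj] := eqVneq l j]);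
    rewrite ?fE /= ?pc ?qc ?conjCK ?mxE ?ki ?kj ?li ?lj ?eqxx
      ?ji ?(negPf ij) ?(eq_sym i l) ?(eq_sym j l) ?(negPf ki) ?(negPf kj)
      ?(negPf li) ?(negPf lj) /= ?(mulr0, addr0, mulr1, add0r) //.
  - by rewrite -pq; ring.
  - by ring.
  - by ring.
  - by rewrite -pq; ring.
move=> k; rewrite formW /r.
have [ki|ki] := eqVneq k i.
  rewrite ?fE /= ?pc ?qc ?conjCK.
  rewrite [LHS](_ : _ = p * p * M i i + q * q * (w * w^*) * M j j +
    p * q * (w * M j i + w^* * M i j)); last by ring.
  by rewrite wM mulr0 addr0 pp qq ww mulr1.
have [kj|kj] := eqVneq k j; last by rewrite mxform_delta.
rewrite ?fE /= ?pc ?qc ?conjCK.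
rewrite [LHS](_ : _ = q * q * (w * w^*) * M i i + p * p * M j j -
  p * q * (w * M j i + w^* * M i j)); last by ring.
by rewrite wM mulr0 subr0 pp qq ww mulr1.
Qed.

(** Induction on the number of diagonal entries that differ from their target: each rotation takes
    surplus from an entry above its target, gives it to a later entry below its target, and settles
    at least one of the two. *)
Lemma unitary_diag_dominates n (M : 'M[C]_n) (s : 'I_n -> C) :
  M^t* = M -> (forall i, s i \is Num.real) ->
  (forall i j : 'I_n, (i <= j)%N -> s j <= s i) ->
  (forall j : 'I_n, \sum_(k < n | (k <= j)%N) s k
                      <= \sum_(k < n | (k <= j)%N) M k k) ->
  exists2 W : 'M[C]_n, W \is unitarymx &
    forall k, s k <= (W *m M *m W^t*) k k.
Proof.
move=> + sr sd.
have [m] := ubnP #|[set k | M k k != s k]|.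
elim: m M => // m IH M mM Mh Ms.
have Mr k : M k k \is Num.real by apply/CrealP; rewrite -[in RHS]Mh !mxE.
have [/forallP sM|/forallPn[k0 k0P]] := boolP [forall k, s k <= M k k].
  exists 1%:M; first by apply/unitarymxP; rewrite Defs.adj1 mulmx1.
  by move=> k; rewrite Defs.adj1 mul1mx mulmx1.
have [k kP kmin] :=
  @arg_minnP _ k0 (fun k => ~~ (s k <= M k k)) (@nat_of_ord n) k0P.
have sMk (l : 'I_n) : (l < k)%N -> s l <= M l l.
  by move=> lk; apply: contraLR lk => /kmin; rewrite -leqNgt.
have Mk : M k k < s k by rewrite real_ltNge.
(* Without a strict surplus before the first deficient index k, the prefix sum up to k would force s
   k <= M k k. *)
have /existsP[i /andP[ik si]] : [exists i : 'I_n, (i < k)%N && (s i < M i i)].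
  apply: contraLR kP => /existsPn h; rewrite negbK; have := Ms k.
  rewrite (bigD1 k) //= [leRHS](bigD1 k) //= => hk; rewrite -subr_ge0.
  have : 0 <= M k k - s k + (\sum_(l < n | (l <= k)%N && (l != k)) M l l -
      \sum_(l < n | (l <= k)%N && (l != k)) s l).
    by rewrite addrACA -opprD subr_ge0.
  move=> /le_trans; apply; rewrite gerDl subr_le0.
  apply: ler_sum => l /andP[lk nlk].
  have /negPf := h l; rewrite ltn_neqAle lk nlk /= => sl.
  by rewrite real_leNgt // sl.
(* Moving min(x, y) from the i-th diagonal entry to the k-th one keeps the    *)
(* prefix sums dominating and makes one more entry equal to its target.       *)
set x := M i i - s i; set y := s k - M k k.
have x0 : 0 < x by rewrite subr_gt0.
have y0 : 0 < y by rewrite subr_gt0.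
have [t [t0 tx ty txy]] :
    exists t, [/\ 0 < t, t <= x, t <= y & (t == x) || (t == y)].
  have [xy|yx] := real_leP (gtr0_real x0) (gtr0_real y0).
    by exists x; rewrite eqxx.
  by exists y; rewrite eqxx orbT (ltW yx).
have nik : i != k by rewrite -val_eqE /= ltn_eqF.
pose D := M i i - M k k.
(* M k k < s k <= s i gives x <= D, so the weight 1 - t / D lies in [0, 1]; averaging with it
   transfers exactly t. *)
have tD : t <= D.
  apply: (le_trans tx); rewrite lerB //; apply: le_trans (sd _ _ (ltnW ik)).
  exact: ltW.
have D0 : 0 < D := lt_le_trans t0 tD.
have [|W Wu WE] := @diag_average n M i k (1 - t / D) Mh nik.
  rewrite subr_ge0 ler_pdivrMr // mul1r tD lerBlDr lerDl.
  by rewrite divr_ge0 // ltW.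
set M' := W *m M *m W^t* in WE.
have Dn : M i i - M k k != 0 by rewrite lt0r_neq0.
have M'i : M' i i = M i i - t by rewrite WE eqxx /D; field.
have M'k : M' k k = M k k + t.
  by rewrite WE eq_sym (negPf nik) eqxx /D; field.
have M'l l : l != i -> l != k -> M' l l = M l l.
  by rewrite WE => /negPf-> /negPf->.
have [|||W' W'u W'E] := IH M'.
- rewrite -ltnS; apply: leq_trans mM; rewrite ltnS; apply: proper_card.
  apply/properP; split.
    apply/fintype.subsetP => l; rewrite !inE.
    have [->|li] := eqVneq l i; first by rewrite (gt_eqF si).
    have [->|lk] := eqVneq l k; first by rewrite (lt_eqF Mk).
    by rewrite M'l.
  case/orP: txy => /eqP tE.
    exists i; rewrite !inE; first by rewrite gt_eqF.
    by rewrite M'i tE /x subKr eqxx.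
  exists k; rewrite !inE; first by rewrite lt_eqF.
  by rewrite M'k tE /y subrKC eqxx.
- by rewrite /M' !adjM trmxCK Mh mulmxA.
(* Before k every entry still meets its target, as t <= x. From k on, both i and k are summed and
   the transfer cancels. *)
- move=> j; have [jk|kj] := ltnP j k.
    apply: ler_sum => l lj; have lk := leq_ltn_trans lj jk.
    have [->|li] := eqVneq l i; first by rewrite M'i lerBrDr -lerBrDl.
    by rewrite M'l ?sMk // -val_eqE /= ltn_eqF.
  apply: le_trans (Ms j) _.
  have ij : (i <= j)%N := leq_trans (ltnW ik) kj.
  rewrite (bigD1 i) // (bigD1 k) /=; last by rewrite kj eq_sym.
  rewrite [leRHS](bigD1 i) // [in leRHS](bigD1 k) /=; last by rewrite kj eq_sym.
  rewrite M'i M'k !addrA.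
  rewrite (_ : M i i - t + M k k + t = M i i + M k k); last by ring.
  by rewrite lerD2l; apply: ler_sum => l /andP[/andP[_ li] lk]; rewrite M'l.
exists (W' *m W); first exact: mul_unitarymx.
by move=> l; have := W'E l; rewrite /M' adjM !mulmxA.
Qed.

(** * Greedy orthonormalisation of weighted vectors *)

(** [I] records which vector produced each row of E. The second orthogonality clause and the last
    clause say that, at each level of c, the rows and the given vectors span the same space, which
    identifies spectral projections. The first orthogonality clause puts each kept vector in the
    span of the rows up to its own, which gives the trace bound. *)
Lemma greedy_gram_schmidt (K : eqType) n (v : K -> 'rV[C]_n) (c : K -> C)
    (L : seq K) :
  uniq L -> pairwise (fun k l => c l <= c k) L ->
  exists m (E : 'M[C]_(m, n)) (I : 'I_m -> K),
  [/\ E \is unitarymx, injective I, (forall i, I i \in L) &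
      forall k, k \in L -> (v k <= E)%MS] /\
  [/\ forall i j : 'I_m, (i <= j)%N -> c (I j) <= c (I i),
      forall i j : 'I_m, (i < j)%N -> (v (I i) *m E^t*) 0 j = 0,
      forall k i, k \in L -> c (I i) < c k -> (v k *m E^t*) 0 i = 0 &
      forall i (X : 'M[C]_n),
        (forall k, k \in L -> c (I i) <= c k -> (v k <= X)%MS) ->
        (row i E <= X)%MS].
Proof.
elim/last_ind: L => [_ _|L x IH].
  have I : 'I_0 -> K by case.
  exists 0%N, 0, I; split; split=> //; try by case.
  by apply/unitarymxP; rewrite mul0mx; apply/matrixP; case.
rewrite rcons_uniq pairwise_rcons => /andP[xL Lu] /andP[/allP cx Ls].
have [m [E [I [[Eu Iinj IL LE] [Id Eu0 Eu1 EX]]]]] := IH Lu Ls.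
have EE := unitarymxP Eu.
pose w := v x - v x *m E^t* *m E.
have wE : w *m E^t* = 0 by rewrite mulmxBl -[_ *m E *m _]mulmxA EE mulmx1 subrr.
have memP k : k \in rcons L x -> k = x \/ k \in L.
  by rewrite mem_rcons in_cons => /orP[/eqP|]; [left|right].
have LLx k : k \in L -> k \in rcons L x.
  by move=> kL; rewrite mem_rcons in_cons kL orbT.
have xLx : x \in rcons L x by rewrite mem_rcons mem_head.
have vxE : v x = w + v x *m E^t* *m E by rewrite subrK.
(* If v x is already spanned, x is discarded. Its orthogonality clause is vacuous, as c x is at most
   every earlier value. *)
have [w0|w0] := eqVneq w 0.
  exists m, E, I; split; split=> //.
  - by move=> i; exact: LLx.
  - by move=> k /memP[->|/LE//]; rewrite vxE w0 add0r submxMl.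
  - move=> k i /memP[->|]; last exact: Eu1.
    by rewrite le_gtF // cx.
  - by move=> i X XP; apply: EX => k kL; apply: XP; exact: LLx.
pose N := (w *m w^t*) 0 0.
have N0 : 0 < N.
  rewrite lt_def /N -{1 3}[w]trmxCK gram_ge0 andbT.
  apply: contra_neq w0 => N0; have : w^t* = 0 by apply: gram_eq0; rewrite N0.
  by move=> /(congr1 (fun A => A^t*)); rewrite trmxCK trmx0 map_mx0.
pose a := (sqrtC N)^-1.
have a0 : a != 0 by rewrite invr_eq0 sqrtC_eq0 gt_eqF.
have ac : a^* = a by apply/CrealP/ger0_real; rewrite invr_ge0 sqrtC_ge0 ltW.
pose e := a *: w.
have eE : e *m E^t* = 0 by rewrite -scalemxAl wE scaler0.
have Ee : E *m e^t* = 0.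
  by have := congr1 (fun A => A^t*) eE; rewrite Defs.adjM trmxCK trmx0 map_mx0.
have ee : e *m e^t* = 1%:M.
  rewrite linearZ /= map_mxZ /= -scalemxAl -scalemxAr scalerA ac.
  rewrite [w *m _]mx11_scalar -/N scale_scalar_mx.
  by rewrite -expr2 exprVn sqrtCK mulVf // gt_eqF.
pose E' := col_mx E e.
pose I' (i : 'I_(m + 1)) := if fintype.split i is inl k then I k else x.
have I'l k : I' (lshift 1 k) = I k by rewrite /I' (unsplitK (inl k)).
have I'r k : I' (rshift m k) = x by rewrite /I' (unsplitK (inr k)).
have E't : E'^t* = row_mx (E^t* ) (e^t* ) by rewrite tr_col_mx map_row_mx.
have vE'l (u : 'rV_n) k : (u *m E'^t*) 0 (lshift 1 k) = (u *m E^t*) 0 k.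
  by rewrite E't mul_mx_row row_mxEl.
(* Earlier vectors lie in the span of E, to which the new unit vector e is orthogonal. *)
have LE'r (k : K) i : k \in L -> (v k *m E'^t*) 0 (rshift m i) = 0.
  move=> /LE /submxP[D ->]; rewrite E't mul_mx_row row_mxEr.
  by rewrite -mulmxA Ee mulmx0 mxE.
have XE (X : 'M_n) :
    (forall k, k \in rcons L x -> (v k <= X)%MS) -> (E' <= X)%MS.
  move=> XP; have EX' : (E <= X)%MS.
    by apply/row_subP => i; apply: EX => k kL _; apply/XP/LLx.
  rewrite col_mx_sub EX' scalemx_sub // addmx_sub ?XP // -mulNmx.
  by apply: mulmx_sub.
exists (m + 1)%N, E', I'; split; split.
- apply/unitarymxP; rewrite E't mul_col_row EE Ee eE ee.
  by rewrite -scalar_mx_block.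
- move=> i j; case: (split_ordP i) => i' ->; case: (split_ordP j) => j' ->.
  + by rewrite !I'l => /Iinj->.
  + by rewrite I'l I'r => Ix; rewrite -Ix IL in xL.
  + by rewrite I'l I'r => Ix; rewrite Ix IL in xL.
  + by rewrite !ord1.
- by move=> i; case: (split_ordP i) => i' ->; rewrite ?I'l ?I'r ?xLx ?LLx ?IL.
- move=> k /memP[->|/LE kE].
    rewrite vxE addmx_sub //; last first.
      by rewrite (submx_trans (submxMl _ _)) // /E' -addsmxE addsmxSl.
    rewrite (submx_trans _ (_ : (e <= E')%MS)) //; last first.
      by rewrite -addsmxE addsmxSr.
    by rewrite (eqmx_scale _ a0).
  by rewrite (submx_trans kE) // /E' -addsmxE addsmxSl.
- move=> i j; case: (split_ordP i) => i' ->; case: (split_ordP j) => j' ->.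
  + by rewrite !I'l; exact: Id.
  + by rewrite I'l I'r => _; exact/cx/IL.
  + by rewrite /= leqNgt (leq_trans (ltn_ord j')) // leq_addr.
  + by rewrite !I'r.
- move=> i j; case: (split_ordP i) => i' ->; case: (split_ordP j) => j' ->.
  + by rewrite I'l vE'l; exact: Eu0.
  + by rewrite I'l LE'r.
  + by rewrite /= ltnNge (leq_trans (ltnW (ltn_ord j'))) // leq_addr.
  + by rewrite !ord1 ltnn.
- move=> k i; case: (split_ordP i) => i' ->.
    rewrite I'l vE'l => /memP[->|]; last exact: Eu1.
    by rewrite le_gtF // cx.
  rewrite I'r => /memP[->|kL _]; first by rewrite ltxx.
  exact: LE'r.
- move=> i X; case: (split_ordP i) => i' ->.
    rewrite I'l => XP; rewrite /E' rowKu; apply: EX => k kL.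
    by apply: XP; exact: LLx.
  rewrite I'r => XP; apply: submx_trans (row_sub _ _) (XE _ _) => k kLx.
  by apply: XP => //; case/memP: kLx => [->//|]; exact: cx.
Qed.

(** * Diagonalising the join and bounding partial traces *)

(** The row space of such a spectral projection is spanned by the selected rows of U, so inclusions
    can be tested on eigenvectors. *)
Lemma conj_diag_sub m n (U : 'M[C]_n) (p : pred 'I_n) (X : 'M[C]_(m, n)) :
  U \in unitmx ->
  (invmx U *m diag_mx (\row_i (p i)%:R) *m U <= X)%MS
    <-> forall i, p i -> (row i U <= X)%MS.
Proof.
move=> Uu; rewrite -mulmxA eqmxMfull ?row_full_unit ?unitmx_inv //.
have rowE i : row i (diag_mx (\row_j (p j)%:R) *m U) = (p i)%:R *: row i U.
  by rewrite mul_diag_mx; apply/rowP => j; rewrite !mxE.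
split=> [h i pi|h].
  have := rowE i; rewrite pi scale1r => <-.
  by apply: submx_trans h; exact: row_sub.
apply/row_subP => i; rewrite rowE; case: (boolP (p i)) => [/h|_].
  by rewrite scale1r.
by rewrite scale0r sub0mx.
Qed.

Lemma unitary_conj_entry n (E A : 'M[C]_n) l : psdmx A ->
  (E *m A *m E^t*) l l = \sum_i spectral_diag A 0 i *
    `|(row i (spectralmx A) *m E^t*) 0 l| ^+ 2.
Proof.
move=> Ap; rewrite {1}(herm_spectral Ap.1) invmx_unitary ?spectral_unitarymx //.
set U := spectralmx A.
have -> : E *m (U^t* *m diag_mx (spectral_diag A) *m U) *m E^t* =
    (U *m E^t*)^t* *m diag_mx (spectral_diag A) *m (U *m E^t*).
  by rewrite Defs.adjM trmxCK !mulmxA.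
rewrite mxE; apply: eq_bigr => i _; rewrite -row_mul mul_mx_diag normCK.
rewrite ![(row _ _) _ _]mxE [LHS]mulrC mxE mulrC [((_)^t* ) _ _]mxE mxE.
ring.
Qed.

Lemma spectral_join_eigenbasis n (A B : 'M[C]_n) : psdmx A -> psdmx B ->
  exists (E : 'M[C]_n) (s : 'I_n -> C),
  [/\ E \is unitarymx, (forall i, 0 <= s i),
      (forall i j : 'I_n, (i <= j)%N -> s j <= s i),
      spectral_join A B = invmx E *m diag_mx (\row_i s i) *m E &
      forall j : 'I_n, \sum_(k < n | (k <= j)%N) s k <=
        \sum_(k < n | (k <= j)%N) (E *m (A + B) *m E^t*) k k].
Proof.
move=> Ap Bp.
pose K : finType := ('I_n + 'I_n)%type.
pose v (k : K) := match k with
  inl i => row i (spectralmx A) | inr i => row i (spectralmx B) end.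
pose c (k : K) := match k with
  inl i => spectral_diag A 0 i | inr i => spectral_diag B 0 i end.
have c0 k : 0 <= c k by case: k => i; exact: psd_diag_ge0.
have cr k : c k \is Num.real := ger0_real (c0 k).
pose r := fun k l : K => c l <= c k.
have rtr : transitive r by move=> l k h kl lh; exact: le_trans lh kl.
have rtot : total r by move=> k l; exact: real_leVge.
pose L := path.sort r (enum K).
have LK k : k \in L by rewrite path.mem_sort mem_enum.
have [||m [E [I [[Eu Iinj _ LE] [Id Eu0 Eu1 EX]]]]] :=
  @greedy_gram_schmidt K n v c L.
- by rewrite path.sort_uniq enum_uniq.
- by rewrite -path.sorted_pairwise // path.sort_sorted.
(* The eigenvectors of A alone span the whole space, so E is square. *)
have mn : m = n.
  apply/eqP; rewrite -(mxrank_unitary Eu); apply/eqP/eqP.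
  rewrite -/(row_full E) -sub1mx.
  rewrite -(mulVmx (spectral_unit A)) mulmx_sub //; apply/row_subP => i.
  exact: (LE (inl i) (LK _)).
subst m.
have Euu := unitarymx_unit Eu.
exists E, (fun i => c (I i)); split=> //.
  have Sp : psdmx (invmx E *m diag_mx (\row_i c (I i)) *m E).
    by apply: conj_diag_psd => // i; rewrite mxE.
  apply: spectral_sup_uniq (spectral_joinP Ap Bp) _.
  apply: spectral_supP => // x x0; apply/eqmxP.
  rewrite (spectral_proj_diag _ Sp.1 Euu erefl).
  set P := invmx E *m _ *m E.
  have PX m (X : 'M_(m, n)) : (P <= X)%MS <->
      forall i, x < c (I i) -> (row i E <= X)%MS.
    have -> : P = invmx E *m diag_mx (\row_i (x < c (I i))%R%:R) *m E.
      by congr (_ *m diag_mx _ *m _); apply/rowP => i; rewrite !mxE.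
    exact: conj_diag_sub.
  (* Expand v k along E: coefficients on rows of level at most x vanish, since that level is below c
     k. *)
  have vP k : x < c k -> (v k <= P)%MS.
    move=> xk; rewrite -[v k](mulmxKtV _ Eu erefl) mulmx_sum_row.
    apply: summx_sub => i _.
    have [xi|ix] := real_ltP (gtr0_real x0) (cr (I i)).
      by apply: scalemx_sub; exact: (PX _ P).1 (submx_refl P) i xi.
    by rewrite Eu1 ?scale0r ?sub0mx // (le_lt_trans ix).
  have AX := conj_diag_sub _ _ (spectral_unit A).
  have BX := conj_diag_sub _ _ (spectral_unit B).
  rewrite addsmx_sub; apply/and3P; split.
  - apply/PX => i xi; apply: EX => -[] k _ /(lt_le_trans xi) xk.
      by apply: submx_trans (addsmxSl _ _); move: k xk; apply/AX.
    by apply: submx_trans (addsmxSr _ _); move: k xk; apply/BX.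
  - by apply/AX => i /(vP (inl i)).
  - by apply/BX => i /(vP (inr i)).
move=> j.
have entryE l : (E *m (A + B) *m E^t*) l l =
    \sum_k c k * `|(v k *m E^t*) 0 l| ^+ 2.
  by rewrite mulmxDr mulmxDl mxE !unitary_conj_entry // big_sumType.
under [leRHS]eq_bigr do rewrite entryE.
rewrite exchange_big /=.
under [leRHS]eq_bigr do rewrite -mulr_sumr.
(* Only the eigenvectors kept at ranks up to j are retained; all the other terms are nonnegative. *)
rewrite (bigID (mem [set I i | i : 'I_n & (i <= j)%N])) /=.
rewrite big_imset /=; last by move=> ? ? _ _; exact: Iinj.
apply: ler_wpDr.
  apply: sumr_ge0 => k _; rewrite mulr_ge0 // sumr_ge0 // => l _.
  by rewrite exprn_ge0.
rewrite [leRHS](eq_bigl (fun i : 'I_n => (i <= j)%N)); last first.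
  by move=> i; rewrite inE.
apply: ler_sum => i ij; rewrite -[leLHS]mulr1 ler_wpM2l //.
(* By Parseval the unit vector v (I i) has squared coefficients of sum 1, and those beyond rank j
   vanish because i <= j. *)
have -> : 1 = \sum_l `|(v (I i) *m E^t*) 0 l| ^+ 2.
  have : (v (I i) *m E^t* *m (v (I i) *m E^t*)^t*) 0 0 = 1.
    rewrite Defs.adjM trmxCK mulmxA mulmxKtV //.
    case: (I i) => k /=; rewrite -dotmxE;
      by rewrite (row_unitarymxP (spectral_unitarymx _)) eqxx.
  rewrite mxE => <-; apply: eq_bigr => l _.
  by rewrite normCK [((_)^t* ) _ _]mxE [(_^T) _ _]mxE.
rewrite [leLHS](bigID (fun l : 'I_n => (l <= j)%N)) /=.
rewrite [X in _ + X]big1 ?addr0 //.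
move=> l; rewrite -ltnNge => jl.
by rewrite Eu0 ?(leq_ltn_trans ij) // normr0 expr0n.
Qed.

End UnitaryMixing.

(** * Assembling the mixing unitaries *)

Theorem corollary3p7 (R : realType) (d : nat) (A B : 'M[R[i]]_d) :
  (1 <= d)%N -> psdmx A -> psdmx B ->
  exists V : 'I_d -> 'M[R[i]]_d,
    (forall i, V i \is unitarymx) /\
    loewner_le (spectral_join A B)
      (d%:R^-1 *: \sum_(i < d) V i *m (A + B) *m (V i)^t*).
Proof.
move=> d0 Ap Bp.
have [E [s [Eu s0 sd -> sM]]] := spectral_join_eigenbasis Ap Bp.
set M := E *m (A + B) *m E^t* in sM.
have Mh : M^t* = M.
  rewrite /M !Defs.adjM trmxCK linearD map_mxD /=.
  by rewrite (hermE A).1 ?(hermE B).1 ?mulmxA //; [case: Bp|case: Ap].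
have [W Wu WM] := unitary_diag_dominates Mh (fun i => ger0_real (s0 i)) sd sM.
set N := W *m M *m W^t* in WM.
have [V [Vu VN]] := pinching N d0.
(* Pass to the eigenbasis of the join, rotate by W, apply the i-th pinching unitary, and return. The
   average is then diagonal in the same basis as the join. *)
exists (fun i => E^t* *m V i *m W *m E); split.
  by move=> i; rewrite !mul_unitarymx // trmxC_unitary.
have -> : \sum_(i < d) E^t* *m V i *m W *m E *m (A + B) *m
      (E^t* *m V i *m W *m E)^t* = E^t* *m (\sum_i V i *m N *m (V i)^t*) *m E.
  rewrite mulmx_sumr mulmx_suml; apply: eq_bigr => i _.
  by rewrite !Defs.adjM trmxCK /N /M !mulmxA.
rewrite scalemxAl scalemxAr VN /loewner_le invmx_unitary //.
rewrite -mulmxBl -mulmxBr -raddfB -(invmx_unitary Eu).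
by apply: conj_diag_psd => // i; have := WM i; rewrite -subr_ge0 !mxE.
Qed.
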